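(* Let $k\ge 1$ be an integer. For every $n\ge 1$ and every $i\ge 0$ the total Betti numbers of the path ideal are $\beta_i(S_{k,n}/I_{k,n})=\binom{k^n}{i}$. Moreover, for every $n\ge 2$, $i\ge 1$ and $j\ge 0$, the graded Betti numbers satisfy the recursion $$\beta_{i-1,j}(I_{k,n})=\beta_{i,j}(S_{k,n}/I_{k,n})=\sum_{s=1}^{k}\ \sum_{\substack{(i_1,\ldots,i_s)\in A_{i,s}\\ (j_1,\ldots,j_s)\in B_{j,s}}}\binom{k}{s}\,\beta_{i_1,j_1}(S_{k,n-1}/I_{k,n-1})\cdots\beta_{i_s,j_s}(S_{k,n-1}/I_{k,n-1}),$$ where $A_{i,s}=\{(i_1,\ldots,i_s)\in\mathbb{Z}^s:\ i_1+\cdots+i_s=i,\ i_1,\ldots,i_s>0\}$ and $B_{j,s}=\{(j_1,\ldots,j_s)\in\mathbb{Z}_{\ge 0}^s:\ j_1+\cdots+j_s=j-s\}$.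
   Context: $T_{k,n}$ is the complete $k$-ary rooted tree of depth $n$: every non-leaf node has exactly $k$ children and all leaves are at distance $n$ from the root (so there are $k^n$ leaves and $\sum_{l=1}^n k^l$ edges). Let $K$ be a field and let $S_{k,n}=K[x_e: e\in E(T_{k,n})]$ be the standard graded polynomial ring with one variable per edge. The path ideal $I_{k,n}\subset S_{k,n}$ is the ideal generated by the $k^n$ monomials $\prod_{e\in P}x_e$, where $P$ runs over the edge sets of the unique paths from the root to each leaf. For a finitely generated graded module $M$ over $S_{k,n}$, $\beta_{i,j}(M)=\dim_K \mathrm{Tor}_i^{S_{k,n}}(M,K)_j$ and $\beta_i(M)=\sum_j\beta_{i,j}(M)$. *)

(* Defs.v *)
From HB Require Import structures.
From mathcomp Require Import all_boot all_order all_algebra.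
From mathcomp Require Import generic_quotient ring_quotient.
From mathcomp Require Import boolp classical_sets functions fsbigop.
From mathcomp Require Import mpoly.

Set Implicit Arguments.
Unset Strict Implicit.
Unset Printing Implicit Defensive.

Import GRing.Theory.

Local Open Scope ring_scope.
Local Open Scope quotient_scope.

(** * Ideals and quotients as modules *)

(* The ideal of R generated by a finite family g, as a submodule of R^o. *)
Definition ideal_gen (R : comNzRingType) (T : finType) (g : T -> R) :
  {pred R^o} := [pred p | `[< exists c : T -> R, p = \sum_t c t * g t >]].

Section IdealModules.
Variables (R : comNzRingType) (T : finType) (g : T -> R).

Fact ideal_gen_submod : submod_closed (ideal_gen g).
Proof.
split=> [|a p q /asboolP[c ->] /asboolP[d ->]]; apply/asboolP.
  by exists (fun=> 0); rewrite big1 // => t _; rewrite mul0r.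
exists (fun t => a * c t + d t).
rewrite -[a *: _]/(a * _) big_distrr -big_split /=.
by apply: eq_bigr => t _; rewrite mulrA mulrDl.
Qed.

HB.instance Definition _ :=
  GRing.isSubmodClosed.Build R R^o (ideal_gen g) ideal_gen_submod.

(* The ideal itself, as an R-module. *)
Record ideal_mod : Type :=
  IdealMod { ideal_val : R^o; _ : ideal_val \in ideal_gen g }.
HB.instance Definition _ := [isSub for ideal_val].
HB.instance Definition _ := [Choice of ideal_mod by <:].
HB.instance Definition _ := [SubChoice_isSubLmodule of ideal_mod by <:].

(* R / ideal, as an R-module. *)
Definition quot_mod : Type := @Quotient.quot R^o (ideal_gen g).
HB.instance Definition _ := GRing.Zmodule.on quot_mod.
HB.instance Definition _ := EqQuotient.on quot_mod.

Definition quot_scale (a : R) (u : quot_mod) : quot_mod :=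
  \pi_quot_mod (a *: (repr u : R^o)).

Fact quot_scale_pi a (p : R^o) :
  quot_scale a (\pi_quot_mod p) = \pi_quot_mod (a *: p).
Proof.
have h : repr (\pi_quot_mod p) - p \in ideal_gen g.
  by rewrite Quotient.idealrBE reprK.
by apply/eqP; rewrite -Quotient.idealrBE -scalerBr rpredZ.
Qed.

Fact pi_quotD (p q : R^o) :
  \pi_quot_mod (p + q) = \pi_quot_mod p + \pi_quot_mod q.
Proof. by rewrite [LHS](@Quotient.pi_add R^o (ideal_gen g)). Qed.

Fact quot_modP (P : quot_mod -> Prop) :
  (forall p : R^o, P (\pi_quot_mod p)) -> forall u, P u.
Proof. by move=> h u; rewrite -[u]reprK. Qed.

Fact quot_scaleA a b u : quot_scale a (quot_scale b u) = quot_scale (a * b) u.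
Proof.
elim/quot_modP: u => p.
by rewrite [quot_scale b _]quot_scale_pi !quot_scale_pi scalerA.
Qed.

Fact quot_scale1 : left_id 1 quot_scale.
Proof. by move=> u; elim/quot_modP: u => p; rewrite quot_scale_pi scale1r. Qed.

Fact quot_scaleDr : right_distributive quot_scale +%R.
Proof.
move=> a u v; elim/quot_modP: u => p; elim/quot_modP: v => q.
by rewrite -pi_quotD !quot_scale_pi scalerDr pi_quotD.
Qed.

Fact quot_scaleDl u : {morph quot_scale^~ u : a b / a + b}.
Proof.
by move=> a b; elim/quot_modP: u => p; rewrite !quot_scale_pi scalerDl pi_quotD.
Qed.

HB.instance Definition _ := GRing.Zmodule_isLmodule.Build R quot_mod
  quot_scaleA quot_scale1 quot_scaleDr quot_scaleDl.

Fact pi_quotZ (a : R) (p : R^o) :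
  \pi_quot_mod (a *: p) = a *: \pi_quot_mod p.
Proof. by rewrite -[RHS]/(quot_scale _ _) quot_scale_pi. Qed.

End IdealModules.

(** * Graded Betti numbers *)

(* The standard graded polynomial ring S = K[x_0, ..., x_(N-1)] acts on graded
   modules given by an S-module M together with its homogeneous components
   gr d (only components of degree d >= 0 occur here).  A graded free
   resolution of M by finitely generated free modules
      ... -> F_2 -> F_1 -> F_0 -> M -> 0,   F_i = \bigoplus_a S(- fr_deg a),
   where F_i consists of row vectors, and the differential F_(i+1) -> F_i is
   right multiplication by fr_diff i.  All maps preserve degrees. *)
Record free_resolution (K : fieldType) (N : nat) (M : lmodType {mpoly K[N]})
    (gr : nat -> set M) : Type := FreeResolution {
  fr_rank : nat -> nat;
  fr_deg : forall i, 'I_(fr_rank i) -> nat;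
  fr_diff : forall i, 'M[{mpoly K[N]}]_(fr_rank i.+1, fr_rank i);
  fr_aug : {linear 'rV[{mpoly K[N]}]_(fr_rank 0) -> M};
  fr_diff_homog : forall i (a : 'I_(fr_rank i.+1)) (b : 'I_(fr_rank i)),
    if (fr_deg b <= fr_deg a)%N
    then fr_diff i a b \is (fr_deg a - fr_deg b)%N.-homog
    else fr_diff i a b == 0;
  fr_aug_homog : forall a : 'I_(fr_rank 0), gr (fr_deg a) (fr_aug (delta_mx 0 a));
  fr_aug_surj : forall m : M, exists v, fr_aug v = m;
  fr_aug_exact : forall v : 'rV_(fr_rank 0),
    fr_aug v = 0 <-> exists w, v = w *m fr_diff 0;
  fr_diff_exact : forall i (v : 'rV_(fr_rank i.+1)),
    v *m fr_diff i = 0 <-> exists w, v = w *m fr_diff i.+1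
}.

Section Betti.
Variables (K : fieldType) (N : nat) (M : lmodType {mpoly K[N]}).
Variable gr : nat -> set M.

Section Tor.
Variable F : free_resolution gr.

(* F_i \otimes_S K is the space of row vectors over K of length fr_rank F i;
   its degree j component is the row space of the following matrix. *)
Definition tensor_comp (i j : nat) : 'M[K]_(fr_rank F i) :=
  diag_mx (\row_a (fr_deg (f := F) a == j)%:R).

(* The differential F_(i+1) \otimes K -> F_i \otimes K: since K = S / (x), the
   entries are evaluated at 0. *)
Definition tensor_diff (i : nat) : 'M[K]_(fr_rank F i.+1, fr_rank F i) :=
  map_mx (meval (fun=> 0)) (fr_diff F i).

Definition tensor_cycles (i j : nat) : 'M[K]_(fr_rank F i) :=
  match i with
  | 0 => tensor_comp 0 j
  | i'.+1 => (tensor_comp i'.+1 j :&: kermx (tensor_diff i'))%MS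
  end.

Definition tensor_boundaries (i j : nat) : 'M[K]_(fr_rank F i.+1, fr_rank F i) :=
  tensor_comp i.+1 j *m tensor_diff i.

(* dim_K H_i(F \otimes K)_j *)
Definition tor_dim (i j : nat) : nat :=
  (\rank (tensor_cycles i j) - \rank (tensor_boundaries i j))%N.

End Tor.

(* dim_K Tor_i(M, K)_j, Tor being computed from a chosen resolution of M;
   the value does not depend on the choice.  (The value 0 in the other case is
   a dummy: every finitely generated graded M has such a resolution.) *)
Definition betti (i j : nat) : nat :=
  if pselect (exists F : free_resolution gr, True) is left exF
  then tor_dim (projT1 (cid exF)) i j else 0.

Definition total_betti (i : nat) : nat :=
  \big[addn/0%N]_(j \in [set: nat]) betti i j.

End Betti.

(** * The path ideal of the complete k-ary tree *)

(* The vertices of T_(k,n) are the words of length at most n over 'I_k, the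
   children of a word being its one-letter extensions on the right; the root is
   the empty word and the leaves are the words of length n.  An edge is
   represented by its endpoint farther from the root, a word of length l + 1
   with l < n. *)
Definition edge (k n : nat) : finType := {l : 'I_n & l.+1.-tuple 'I_k}.
Definition leaf (k n : nat) : finType := n.-tuple 'I_k.

(* Edge set of the path from the root to w. *)
Definition root_path (k n : nat) (w : leaf k n) : {set edge k n} :=
  [set e : edge k n | prefix (tagged e) w].

Definition tree_ring (K : fieldType) (k n : nat) : comNzRingType :=
  {mpoly K[#|edge k n|]}.

Definition path_monomial (K : fieldType) (k n : nat) (w : leaf k n) :
  tree_ring K k n := \prod_(e in root_path w) 'X_(enum_rank e).

(* I_(k,n) and S_(k,n) / I_(k,n) with their gradings. *)
Definition path_ideal (K : fieldType) (k n : nat) :=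
  ideal_mod (@path_monomial K k n).

Definition path_ideal_gr (K : fieldType) (k n d : nat) :
  set (path_ideal K k n) := [set p | ideal_val p \is d.-homog].

Definition path_quot (K : fieldType) (k n : nat) :=
  quot_mod (@path_monomial K k n).

Definition path_quot_gr (K : fieldType) (k n d : nat) :
  set (path_quot K k n) :=
  [set \pi_(path_quot K k n) p |
    p in [set p : tree_ring K k n | p \is d.-homog]].

Definition betti_ideal (K : fieldType) (k n : nat) : nat -> nat -> nat :=
  betti (@path_ideal_gr K k n).

Definition betti_quot (K : fieldType) (k n : nat) : nat -> nat -> nat :=
  betti (@path_quot_gr K k n).

Definition total_betti_quot (K : fieldType) (k n : nat) : nat -> nat :=
  total_betti (@path_quot_gr K k n).

(** * Index sets of the recursion *)

(* Nonnegative tuples with sum i (resp. j - s) have entries at most i (resp. j),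
   which puts them in a finite type.  The equation in B is over the integers, so
   it has no solution when j < s. *)
Definition indexA (i s : nat) : {set {ffun 'I_s -> 'I_i.+1}} :=
  [set a : {ffun 'I_s -> 'I_i.+1} |
    (\sum_(t < s) a t == i)%N && [forall t, 0 < a t]%N].

Definition indexB (j s : nat) : {set {ffun 'I_s -> 'I_j.+1}} :=
  [set b : {ffun 'I_s -> 'I_j.+1} | (\sum_(t < s) b t + s == j)%N].

(* Main.v *)
From HB Require Import structures.
Require Import Defs.
From mathcomp Require Import all_boot all_order all_algebra.
From mathcomp Require Import generic_quotient ring_quotient.
From mathcomp Require Import boolp classical_sets fsbigop.
From mathcomp Require Import finset mpoly zify.

(** The proof rests on the Taylor resolution. For any finite family of monomials
    there is a free resolution of S / I with one generator for each subset A of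
    the family, in homological degree |A| and in the degree of lcm(A); its
    differential has the entries +- lcm(A) / lcm(A minus t). For the path ideal
    the last edge of the path to a leaf w divides the monomial of w and of no
    other leaf (path_mlcm_strict). Hence lcm(A minus w) is always a proper
    divisor of lcm(A), all entries of the differential lie in the maximal ideal
    (taylor_diff_minimal), and the Taylor resolution is minimal. Therefore
    beta_(i,j)(S / I) is the number of sets of i leaves whose paths to the root
    cover exactly j edges (betti_quotE), and truncating the resolution gives the
    Betti numbers of I shifted by one (betti_idealE). Forgetting j leaves all
    i-subsets of the k^n leaves.

    For the recursion, a set of leaves of the tree of depth n + 1 is a choice of
    a possibly empty set of leaves in each of the k subtrees below the root, and
    a subtree that is met costs one more edge. With F_n(x, y) the sum of
    x^|A| y^(edges of A) over all leaf sets A this says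
    F_(n+1) = (1 + y (F_n - 1))^k (forest_gfS), and the recursion is the
    coefficient of x^i y^j in the binomial expansion (lcm_count_rec).

    Two standard facts are established on the way. The first is that Tor
    can be computed from any graded free resolution (bettiE): homogeneous
    comparison maps in both directions exist, they are inverse to each other up
    to homotopy, and tensoring with K then gives mutually bounding dimensions.
    The second is the exactness of the Taylor complex (taylor_exact). It embeds
    into the chain complex of the full simplex on the generators with
    coefficients in S; a cycle is split according to its monomials, and each
    part is coned off from a generator that divides the monomial. *)

Set Implicit Arguments.
Unset Strict Implicit.
Unset Printing Implicit Defensive.

Import GRing.Theory.

(** * Restricting a polynomial to a set of monomials *)

Section Poly.
Local Open Scope ring_scope.
Variables (R : comNzRingType) (N : nat).
Implicit Types (P Q : pred 'X_{1..N}) (p q : {mpoly R[N]}).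

Definition mrestrict P p := \sum_(m <- msupp p | P m) p@_m *: 'X_[m].

Lemma mcoeff_restrict P p m : (mrestrict P p)@_m = if P m then p@_m else 0.
Proof.
rewrite /mrestrict raddf_sum /=.
under eq_bigr do rewrite mcoeffZ mcoeffX.
have [mp|mp] := boolP (m \in msupp p).
  rewrite big_mkcond (bigD1_seq m) //= ?msupp_uniq // eqxx mulr1 big1 ?addr0 //.
  by move=> m' /negbTE ->; rewrite mulr0; case: ifP.
rewrite memN_msupp_eq0 // if_same big1_seq // => m' /andP[_ m'p].
by case: eqP => [e|]; rewrite ?mulr0 //; rewrite -e m'p in mp.
Qed.

Lemma mrestrict_is_additive P : additive (mrestrict P).
Proof.
move=> p q; apply/mpolyP => m; rewrite mcoeffB !mcoeff_restrict mcoeffB.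
by case: (P m); rewrite ?subr0.
Qed.
HB.instance Definition _ P :=
  GRing.isZmodMorphism.Build _ _ (mrestrict P) (mrestrict_is_additive P).

Lemma mrestrict_id P p : (forall m, p@_m != 0 -> P m) -> mrestrict P p = p.
Proof.
move=> h; apply/mpolyP => m; rewrite mcoeff_restrict; case: ifP => // Pm.
by apply/esym/eqP/negPn/negP => /h; rewrite Pm.
Qed.

Lemma mrestrict_eq0 P p :
  (forall m, p@_m != 0 -> ~~ P m) -> mrestrict P p = 0.
Proof.
move=> h; apply/mpolyP => m; rewrite mcoeff_restrict mcoeff0.
by case: ifP => // Pm; apply/eqP/negPn/negP => /h; rewrite Pm.
Qed.

Lemma mcoeffM_neq0 p q m : (p * q)@_m != 0 ->
  exists m1 m2, [/\ p@_m1 != 0, q@_m2 != 0 & m = (m1 + m2)%MM].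
Proof.
rewrite -mcoeff_msupp => /msuppM_le /allpairsP[[m1 m2]] /= [].
by rewrite !mcoeff_msupp => h1 h2 ->; exists m1, m2.
Qed.

(** Multiplying by q moves the monomials selected by P' onto monomials selected
    by P, and the others onto monomials rejected by P. For P a condition on the
    degree and q homogeneous, this is the compatibility of a product with the
    homogeneous components. *)
Lemma mrestrictM P P' p q :
  (forall u v, q@_v != 0 -> P (u + v)%MM = P' u) ->
  mrestrict P (p * q) = mrestrict P' p * q.
Proof.
move=> PP'.
have split_p : p = mrestrict P' p + mrestrict (predC P') p.
  apply/mpolyP => u; rewrite mcoeffD !mcoeff_restrict /=.
  by case: (P' u); rewrite ?addr0 ?add0r.
have PE Q u : (mrestrict Q p * q)@_u != 0 -> exists2 v, Q v & P u = P' v.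
  case/mcoeffM_neq0 => u1 [u2 [h1 h2 ->]]; exists u1; last exact: PP'.
  by move: h1; rewrite mcoeff_restrict; case: ifP; rewrite ?eqxx.
rewrite {1}split_p mulrDl raddfD /= (mrestrict_id (P := P)); last first.
  by move=> u /PE[v Qv ->].
by rewrite (mrestrict_eq0 (P := P)) ?addr0 // => u /PE[v Qv ->].
Qed.

Lemma mcoeff_sum_neq0 (I : finType) (A : pred I) (F : I -> {mpoly R[N]}) m :
  (\sum_(i | A i) F i)@_m != 0 -> exists2 i, A i & (F i)@_m != 0.
Proof.
rewrite raddf_sum => h; apply: contrapT => h'; case/negP: h.
by rewrite big1 // => i Ai; apply/eqP/negPn/negP => Fi; case: h'; exists i.
Qed.

Lemma mcoeff_sign_neq0 k p m : ((-1) ^+ k * p)@_m != 0 -> p@_m != 0.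
Proof.
by rewrite -signr_odd mulr_sign; case: (odd k); rewrite ?mcoeffN ?oppr_eq0.
Qed.

End Poly.

(** * Matrices of homogeneous maps between graded free modules *)

Section HomogMx.
Local Open Scope ring_scope.
Variables (R : comNzRingType) (N : nat).
Local Notation S := {mpoly R[N]}.

(** A nonzero entry (a, b) must be homogeneous of degree d a - e b.
    Phrasing this through the exponents that occur avoids truncated
    subtraction: when e b exceeds d a no exponent can occur and the entry is
    0. *)
Definition homog_mx m n (d : 'I_m -> nat) (e : 'I_n -> nat)
    (A : 'M[S]_(m, n)) :=
  forall a b u, (A a b)@_u != 0 -> (mdeg u + e b)%N = d a.

Lemma homog_mxM m n p d e f (A : 'M[S]_(m, n)) (B : 'M[S]_(n, p)) :
  homog_mx d e A -> homog_mx e f B -> homog_mx d f (A *m B).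
Proof.
move=> hA hB a b u; rewrite mxE => /mcoeff_sum_neq0[c _].
case/mcoeffM_neq0 => u1 [u2 [/hA h1 /hB h2 ->]].
by rewrite mdegD -addnA h2 h1.
Qed.

Lemma homog_mxB m n d e (A B : 'M[S]_(m, n)) :
  homog_mx d e A -> homog_mx d e B -> homog_mx d e (A - B).
Proof.
move=> hA hB a b u; rewrite !mxE mcoeffB => h.
have [z|/hA//] := eqVneq (A a b)@_u 0.
by apply: hB; move: h; rewrite z sub0r oppr_eq0.
Qed.

Lemma homog_mx1 n d : homog_mx d d (1%:M : 'M[S]_n).
Proof.
move=> a b u; rewrite mxE; case: (eqVneq a b) => [->|_]; last first.
  by rewrite mulr0n mcoeff0 eqxx.
rewrite mulr1n mcoeff1; case: (eqVneq u 0%MM) => [->|_]; first by rewrite mdeg0.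
by rewrite mulr0n eqxx.
Qed.

(** The degree-0 component of the map A from the free module with generators in
    degrees d to the free module with generators in degrees e. *)
Definition homog_part m n (d : 'I_m -> nat) (e : 'I_n -> nat)
    (A : 'M[S]_(m, n)) :=
  \matrix_(a, b) mrestrict (fun u => (mdeg u + e b)%N == d a) (A a b).

Lemma homog_part_homog m n d e (A : 'M[S]_(m, n)) :
  homog_mx d e (homog_part d e A).
Proof.
move=> a b u; rewrite mxE mcoeff_restrict.
by case: ifP => [/eqP|]; rewrite ?eqxx.
Qed.

Lemma homog_part_id m n d e (A : 'M[S]_(m, n)) :
  homog_mx d e A -> homog_part d e A = A.
Proof.
move=> hA; apply/matrixP => a b; rewrite mxE mrestrict_id // => u /hA ->.
exact: eqxx.
Qed.

Lemma homog_partM m n p d e f (A : 'M[S]_(m, n)) (B : 'M[S]_(n, p)) :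
  homog_mx e f B -> homog_part d f (A *m B) = homog_part d e A *m B.
Proof.
move=> hB; apply/matrixP => a b; rewrite !mxE raddf_sum /=.
apply: eq_bigr => c _; rewrite mxE.
apply: mrestrictM => u v /hB e_v.
by rewrite mdegD -addnA e_v.
Qed.

(** A lift obtained by solving for each row separately need not be homogeneous.
    Its degree-0 component is still a lift, because taking that component
    commutes with right multiplication by the homogeneous matrix D. *)
Lemma homog_lift_mx m n p d e f (D : 'M[S]_(n, p)) (E : 'M[S]_(m, p)) :
  homog_mx e f D -> homog_mx d f E ->
  (forall a, exists w, row a E = w *m D) ->
  exists X, homog_mx d e X /\ E = X *m D.
Proof.
move=> hD hE /choice[w hw]; pose X := \matrix_a w a.
exists (homog_part d e X); split; first exact: homog_part_homog.
rewrite -(homog_partM _ _ hD) -[LHS](homog_part_id hE); congr homog_part.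
by apply/row_matrixP => a; rewrite row_mul rowK hw.
Qed.

(** The map induced by A after tensoring with K = S / (x). *)
Definition mx_at0 m n (A : 'M[S]_(m, n)) : 'M[R]_(m, n) :=
  map_mx (meval (fun=> 0)) A.

Lemma meval0_coeff (p : S) : p.@[fun=> 0] = p@_0%MM.
Proof.
have h0 m : m != 0%MM :> 'X_{1..N} -> \prod_(i < N) (0 : R) ^+ m i = 0.
  move=> m0; have [i mi] : exists i, m i != 0%N.
    apply: contrapT => /forallNP h'; case/eqP: m0; apply/mnmP => i.
    by rewrite mnm0E; apply/eqP/negPn/negP.
  by rewrite (bigD1 i) //= expr0n (negbTE mi) mul0r.
rewrite mevalE (bigID (pred1 0%MM)) /= [X in _ + X]big1 => [|m /h0 ->];
  last by rewrite mulr0.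
rewrite addr0 -[RHS]mulr1 -[X in _ = _ * X](_ : \prod_(i < N) 0 ^+ 0%MM i = 1);
  last by rewrite big1 // => i _; rewrite mnm0E.
have [h|h] := boolP (0%MM \in msupp p).
  by rewrite -big_filter filter_pred1_uniq ?msupp_uniq // big_seq1.
rewrite (memN_msupp_eq0 h) mul0r big1_seq // => m /andP[/eqP-> hp].
by rewrite hp in h.
Qed.

Lemma mx_at0_homog m n d e (A : 'M[S]_(m, n)) a b :
  homog_mx d e A -> mx_at0 A a b != 0 -> e b = d a.
Proof. by move=> hA; rewrite mxE meval0_coeff => /hA; rewrite mdeg0. Qed.

Definition deg_mx n (d : 'I_n -> nat) j : 'M[R]_n :=
  diag_mx (\row_a (d a == j)%:R).

(** Modulo the variables only the entries of degree 0 survive, so a homogeneous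
    map preserves the splitting of the generators by degree. *)
Lemma deg_mx_at0 m n d e (A : 'M[S]_(m, n)) j : homog_mx d e A ->
  deg_mx d j *m mx_at0 A = mx_at0 A *m deg_mx e j.
Proof.
move=> hA; apply/matrixP => a b; rewrite mul_diag_mx mul_mx_diag !mxE.
have [->|h] := eqVneq (A a b).@[fun=> 0] 0; first by rewrite mulr0 mul0r.
have /esym -> : e b = d a by apply: mx_at0_homog hA _; rewrite mxE.
by rewrite mulrC.
Qed.

Lemma mx_at0M m n p (A : 'M[S]_(m, n)) (B : 'M[S]_(n, p)) :
  mx_at0 (A *m B) = mx_at0 A *m mx_at0 B.
Proof. exact: map_mxM. Qed.

Lemma mx_at0B m n (A B : 'M[S]_(m, n)) : mx_at0 (A - B) = mx_at0 A - mx_at0 B.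
Proof. exact: map_mxB. Qed.

Lemma mx_at0D m n (A B : 'M[S]_(m, n)) : mx_at0 (A + B) = mx_at0 A + mx_at0 B.
Proof. exact: map_mxD. Qed.
Lemma mx_at01 n : mx_at0 1%:M = 1%:M :> 'M_n.
Proof. exact: map_mx1. Qed.

End HomogMx.

(** * Independence of the resolution *)

(** Comparison maps and homotopies are families of matrices whose sizes vary
    with the index and whose next member depends on the previous one; this is
    the form of dependent choice that builds them. *)
Lemma dep_choice (X : nat -> Type) (P : forall i, X i -> Prop)
    (Q : forall i, X i -> X i.+1 -> Prop) :
  (exists x, P 0 x) ->
  (forall i x, P i x -> exists y, P i.+1 y /\ Q i x y) ->
  exists f : forall i, X i, forall i, P i (f i) /\ Q i (f i) (f i.+1).
Proof.
move=> h0 hS.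
have hS' i (s : {x | P i x}) : {y : {y | P i.+1 y} | Q i (sval s) (sval y)}.
  case: s => x Px; have [y [Py Qy]] := cid (hS i x Px).
  by exists (exist _ y Py).
pose s := fix s i : {x | P i x} :=
  if i is i'.+1 then sval (hS' i' (s i')) else cid h0.
exists (fun i => sval (s i)) => i; split; first exact: svalP.
exact: svalP (hS' i (s i)).
Qed.

Section Comparison.
Local Open Scope ring_scope.

(** If g after f is the identity up to boundaries, then f is injective on
    homology: a cycle z with z f in B' has z f g in B, and z differs from z f g
    by an element of B. The ranks are compared by mapping Z and Z' to the
    quotient by B', which is right multiplication by cokermx B'. *)
Lemma rank_homology_le (K : fieldType) m1 m2 n1 n2 b1 b2
    (Z : 'M[K]_(m1, n1)) (B : 'M[K]_(b1, n1))
    (Z' : 'M[K]_(m2, n2)) (B' : 'M[K]_(b2, n2))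
    (f : 'M[K]_(n1, n2)) (g : 'M[K]_(n2, n1)) :
  (Z *m f <= Z')%MS -> (B' <= Z')%MS -> (B' *m g <= B)%MS ->
  (Z *m (f *m g - 1%:M) <= B)%MS ->
  (\rank Z - \rank B <= \rank Z' - \rank B')%N.
Proof.
move=> hf hB' hg hh; pose C := cokermx B'.
have h1 := mxrank_mul_ker Z (f *m C).
have h2 := mxrank_mul_ker Z' C.
have h3 : (\rank (Z *m (f *m C)) <= \rank (Z' *m C))%N.
  by rewrite mulmxA mxrankS // submxMr.
have h4 : (\rank B' <= \rank (Z' :&: kermx C))%N.
  by rewrite mxrankS // sub_capmx hB' sub_kermx mulmx_coker eqxx.
have h5 : (\rank (Z :&: kermx (f *m C)) <= \rank B)%N.
  rewrite mxrankS //; set W := (Z :&: _)%MS.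
  have WZ : (W <= Z)%MS by exact: capmxSl.
  have : (W *m f <= B')%MS.
    by rewrite submxE -mulmxA -sub_kermx capmxSr.
  move=> /(submxMr g) /submx_trans /(_ hg) Wfg.
  have : (W *m (f *m g - 1%:M) <= B)%MS.
    by apply: submx_trans hh; exact: submxMr.
  rewrite mulmxBr mulmx1 mulmxA => h.
  by rewrite -[W](subKr (W *m f *m g)) addmx_sub // eqmx_opp.
lia.
Qed.

(** The diagonal matrices of P and of its complement add up to the identity, so
    the obvious upper bounds on their ranks are both attained. *)
Lemma rank_pred_mx (K : fieldType) n (P : pred 'I_n) :
  \rank (diag_mx (\row_a (P a)%:R) : 'M[K]_n) = #|P|.
Proof.
have le (Q : pred 'I_n) :
    (\rank (diag_mx (\row_a (Q a)%:R) : 'M[K]_n) <= #|Q|)%N.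
  have -> : diag_mx (\row_a (Q a)%:R) = \sum_(a | Q a) delta_mx a a :> 'M[K]_n.
    apply/matrixP => a b; rewrite summxE !mxE.
    under eq_bigr do rewrite mxE.
    rewrite big_mkcond (bigD1 a) //= eqxx big1 ?addr0 => [|c ca].
      by case: (Q a); rewrite ?mul0rn // eq_sym.
    by rewrite (eq_sym a) (negbTE ca) if_same.
  rewrite -sum1_card; apply: (big_ind2 (fun (A : 'M[K]_n) c => \rank A <= c)%N).
  - by rewrite mxrank0.
  - move=> A1 c1 A2 c2 h1 h2.
    exact: leq_trans (mxrank_add _ _) (leq_add h1 h2).
  - by move=> a _; rewrite mxrank_delta.
apply/eqP; rewrite eqn_leq le /= -(leq_add2r #|predC P|) cardC card_ord.
apply: leq_trans (leq_add (leqnn _) (le (predC P))).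
rewrite -[X in (X <= _)%N](mxrank1 K); apply: leq_trans (mxrank_add _ _).
rewrite -raddfD /= [X in diag_mx X](_ : _ = const_mx 1) ?diag_const_mx //.
by apply/rowP => a; rewrite !mxE /=; case: (P a); rewrite ?addr0 ?add0r.
Qed.

Variables (K : fieldType) (N : nat) (M : lmodType {mpoly K[N]}).
Variable gr : nat -> set M.
Local Notation S := {mpoly K[N]}.

(** The family gr consists of arbitrary subsets. To compare resolutions,
    homogeneous elements of M need well-defined degrees that are compatible with
    the degrees in S. This is expressed by maps pr d taking the component of
    degree d: on p *: m with m of degree e, that component is the part of p of
    degree d - e applied to m. *)
Definition graded := exists pr : nat -> M -> M,
  (forall d, additive (pr d)) /\
  forall d e (p : S) m, gr e m ->
    pr d (p *: m) = mrestrict (fun u => (mdeg u + e)%N == d) p *: m.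

Lemma fr_diff_homog_mx (F : free_resolution gr) i :
  homog_mx (@fr_deg _ _ _ _ F i.+1) (@fr_deg _ _ _ _ F i) (fr_diff F i).
Proof.
move=> a b u; have := @fr_diff_homog _ _ _ _ F i a b.
case: leqP => [le /dhomogP h|_ /eqP ->]; last by rewrite mcoeff0 eqxx.
by rewrite -mcoeff_msupp => /h/= ->; rewrite subnK.
Qed.

Lemma fr_diffM (F : free_resolution gr) i : fr_diff F i.+1 *m fr_diff F i = 0.
Proof.
apply/row_matrixP => a; rewrite row_mul row0; apply/fr_diff_exact.
by exists (delta_mx 0 a); rewrite -rowE.
Qed.

Lemma fr_aug_diff (F : free_resolution gr) w : fr_aug F (w *m fr_diff F 0) = 0.
Proof. by apply/fr_aug_exact; exists w. Qed.

(** Any preimage v of m can be replaced by its component of degree d, since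
    applying pr d to the image of v only keeps the image of that component. *)
Lemma graded_lift (F : free_resolution gr) d m : graded -> gr d m ->
  exists v, homog_mx (fun=> d) (@fr_deg _ _ _ _ F 0) v /\ fr_aug F v = m.
Proof.
move=> [pr [prB prZ]] grm; have [v vm] := fr_aug_surj F m.
exists (homog_part (fun=> d) (@fr_deg _ _ _ _ F 0) v); split.
  exact: homog_part_homog.
(* The case p = 1 of the defining property of pr. *)
have prm : pr d m = m.
  rewrite -[in LHS](scale1r m) (prZ _ _ _ _ grm) mrestrict_id ?scale1r // => u.
  rewrite mcoeff1; case: (eqVneq u 0%MM) => [->|_]; first by rewrite mdeg0 eqxx.
  by rewrite mulr0n eqxx.
pose prd := GRing.isZmodMorphism.Build _ _ (pr d) (prB d).
pose prA : {additive M -> M} := HB.pack (pr d) prd.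
rewrite -[RHS]prm -vm -[pr d]/(prA : M -> M).
rewrite [X in fr_aug F X = _]row_sum_delta.
rewrite [X in _ = prA (fr_aug F X)]row_sum_delta.
rewrite !raddf_sum; apply: eq_bigr => b _.
by rewrite /= !linearZZ (prZ _ _ _ _ (fr_aug_homog b)) mxE.
Qed.

Section ChainMap.
Variables F G : free_resolution gr.
Hypothesis grM : graded.
Local Notation dF := (@fr_deg _ _ _ _ F).
Local Notation dG := (@fr_deg _ _ _ _ G).

(** The comparison theorem: free modules are projective, so the identity of M
    lifts step by step along the exact complex G. The induction carries along
    that d_F f lands in the image of d_G, which is what makes the next step
    solvable. *)
Lemma chain_map_exists : exists f : forall i, 'M[S]_(fr_rank F i, fr_rank G i),
  [/\ forall i, homog_mx (@dF i) (@dG i) (f i),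
      forall v, fr_aug G (v *m f 0) = fr_aug F v &
      forall i, fr_diff F i *m f i = f i.+1 *m fr_diff G i].
Proof.
(* Compatibility with the augmentations only concerns the index 0. *)
pose aug_ok i := match i return 'M[S]_(fr_rank F i, fr_rank G i) -> Prop with
  | 0 => fun f => forall v, fr_aug G (v *m f) = fr_aug F v
  | _ => fun=> True end.
pose P i (f : 'M[S]_(fr_rank F i, fr_rank G i)) :=
  [/\ homog_mx (@dF i) (@dG i) f, aug_ok i f &
  forall a, exists w, row a (fr_diff F i *m f) = w *m fr_diff G i].
pose Q i f (f' : 'M[S]_(fr_rank F i.+1, fr_rank G i.+1)) :=
  fr_diff F i *m f = f' *m fr_diff G i.
have [||f hf] := @dep_choice _ P Q.
- have [w hw] :=
    choice (fun a => graded_lift G grM (@fr_aug_homog _ _ _ _ F a)).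
  pose f := \matrix_a w a; have fE a : row a f = w a by exact: rowK.
  have fok : aug_ok 0 f.
    move=> v; rewrite [in LHS](row_sum_delta v) mulmx_suml.
    rewrite [in RHS](row_sum_delta v) !raddf_sum; apply: eq_bigr => a _.
    by rewrite -scalemxAl /= !linearZZ -rowE fE (hw a).2.
  exists f; split=> // [a b u|a].
    by have := (hw a).1 0 b u; rewrite -fE mxE.
  apply/fr_aug_exact; rewrite row_mul fok rowE.
  exact: fr_aug_diff.
- move=> i f [hf _ him].
  have [f' [hf' e]] := homog_lift_mx (@fr_diff_homog_mx G i)
    (homog_mxM (@fr_diff_homog_mx F i) hf) him.
  exists f'; split=> //; split=> // a; apply/fr_diff_exact.
  by rewrite -row_mul -mulmxA -e mulmxA fr_diffM mul0mx row0.
exists f; split=> [i|v|i]; [by case: (hf i) => -[] | | by case: (hf i)].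
by case: (hf 0) => -[_ + _] _; exact.
Qed.

End ChainMap.

(** A chain map t lifting 0 is homotopic to 0: once h i is found, the error
    t (i+1) - d h i is killed by d, hence factors through the next differential
    by exactness. *)
Lemma null_homotopy (F : free_resolution gr)
    (t : forall i, 'M[S]_(fr_rank F i, fr_rank F i)) :
  (forall i, homog_mx (@fr_deg _ _ _ _ F i) (@fr_deg _ _ _ _ F i) (t i)) ->
  (forall v, fr_aug F (v *m t 0) = 0) ->
  (forall i, fr_diff F i *m t i = t i.+1 *m fr_diff F i) ->
  exists h : forall i, 'M[S]_(fr_rank F i, fr_rank F i.+1),
    [/\ forall i, homog_mx (@fr_deg _ _ _ _ F i) (@fr_deg _ _ _ _ F i.+1) (h i),
      t 0 = h 0 *m fr_diff F 0 &
      forall i, t i.+1 = fr_diff F i *m h i + h i.+1 *m fr_diff F i.+1].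
Proof.
move=> ht taug tdiff.
have hd := @fr_diff_homog_mx F.
pose P i (h : 'M[S]_(fr_rank F i, fr_rank F i.+1)) :=
  [/\ homog_mx (@fr_deg _ _ _ _ F i) (@fr_deg _ _ _ _ F i.+1) h,
    fr_diff F i *m (t i - h *m fr_diff F i) = 0 &
    match i return 'M[S]_(fr_rank F i, fr_rank F i.+1) -> Prop with
    | 0 => fun h => t 0 = h *m fr_diff F 0 | _ => fun=> True end h].
pose Q i h (h' : 'M[S]_(fr_rank F i.+1, fr_rank F i.+2)) :=
  t i.+1 = fr_diff F i *m h + h' *m fr_diff F i.+1.
have [||h hh] := @dep_choice _ P Q.
- have [|h [hh e]] := homog_lift_mx (hd 0) (ht 0).
    by move=> a; apply/fr_aug_exact; rewrite rowE.
  by exists h; split=> //; rewrite e subrr mulmx0.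
- move=> i h [hh e _].
  have hE : homog_mx (@fr_deg _ _ _ _ F i.+1) (@fr_deg _ _ _ _ F i.+1)
     (t i.+1 - fr_diff F i *m h) by apply: homog_mxB (homog_mxM _ hh).
  have [|h' [hh' e']] := homog_lift_mx (hd i.+1) hE.
    move=> a; apply/fr_diff_exact; rewrite -row_mul.
    by rewrite mulmxBl -tdiff -mulmxA -mulmxBr e row0.
  exists h'; split; last by rewrite /Q -e' addrC subrK.
  split=> //; rewrite -e' opprB addrC subrK.
  by rewrite mulmxA fr_diffM mul0mx.
exists h; split=> [i||i]; [by case: (hh i) => -[] | | by case: (hh i)].
by case: (hh 0) => -[].
Qed.

Section Tor.
Variables F G : free_resolution gr.
Hypothesis grM : graded.

(** Lifting the identity of M in both directions gives f and g, and f g - 1 is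
    null-homotopic; after tensoring with K this is the situation of
    rank_homology_le in each degree j. Exchanging F and G gives equality. *)
Lemma tor_dim_le i j : (tor_dim F i j <= tor_dim G i j)%N.
Proof.
have [f [hf faug fdiff]] := chain_map_exists F G grM.
have [g [hg gaug gdiff]] := chain_map_exists G F grM.
have [|||h [hh h0 hS]] :=
  null_homotopy (F := F) (t := fun i => f i *m g i - 1%:M).
- by move=> i'; apply: homog_mxB (homog_mxM _ _) (@homog_mx1 _ _ _ _).
- move=> v; rewrite mulmxBr mulmx1 raddfB /= mulmxA gaug faug subrr //.
- move=> i'; rewrite mulmxBr mulmxBl mulmx1 mul1mx mulmxA fdiff.
  by rewrite -mulmxA gdiff mulmxA.
have tF l : tensor_diff F l = mx_at0 (fr_diff F l) by [].
have tG l : tensor_diff G l = mx_at0 (fr_diff G l) by [].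
have cF l : tensor_comp F l j = deg_mx _ (@fr_deg _ _ _ _ F l) j by [].
have cG l : tensor_comp G l j = deg_mx _ (@fr_deg _ _ _ _ G l) j by [].
apply: (@rank_homology_le _ _ _ _ _ _ _ (tensor_cycles F i j)
  (tensor_boundaries F i j) (tensor_cycles G i j) (tensor_boundaries G i j)
  (mx_at0 (f i)) (mx_at0 (g i))).
- case: i => [|i] /=; first by rewrite cF cG (deg_mx_at0 _ (hf 0)) submxMl.
  rewrite sub_capmx; apply/andP; split.
    apply: (submx_trans (submxMr _ (capmxSl _ _))).
    by rewrite cF cG (deg_mx_at0 _ (hf _)) submxMl.
  rewrite sub_kermx tG -mulmxA -mx_at0M -fdiff mx_at0M mulmxA.
  by rewrite -tF (sub_kermxP (capmxSr _ _)) mul0mx.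
- have sub : (tensor_boundaries G i j <= tensor_comp G i j)%MS.
    rewrite /tensor_boundaries tG cG (deg_mx_at0 _ (@fr_diff_homog_mx G i)).
    exact: submxMl.
  case: i sub => [|i] //= sub; rewrite sub_capmx sub sub_kermx /=.
  rewrite /tensor_boundaries !tG -mulmxA -mx_at0M fr_diffM.
  by rewrite /mx_at0 map_mx0 mulmx0.
- rewrite /tensor_boundaries tG tF -mulmxA -mx_at0M gdiff mx_at0M mulmxA.
  by rewrite cG cF (deg_mx_at0 _ (hg i.+1)) -mulmxA submxMl.
- have -> : mx_at0 (f i) *m mx_at0 (g i) - 1%:M = mx_at0 (f i *m g i - 1%:M).
    by rewrite mx_at0B mx_at0M mx_at01.
  case: i => [|i].
    rewrite h0 mx_at0M mulmxA -tF; apply: submxMr.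
    by rewrite /= !cF (deg_mx_at0 _ (hh 0)) submxMl.
  rewrite hS mx_at0D mulmxDr !mx_at0M !mulmxA.
  rewrite -tF (sub_kermxP (capmxSr _ _)) mul0mx add0r -tF.
  apply: submxMr; apply: submx_trans (submxMr _ (capmxSl _ _)) _.
  by rewrite !cF (deg_mx_at0 _ (hh i.+1)) submxMl.
Qed.

End Tor.

Lemma bettiE (F : free_resolution gr) i j :
  graded -> betti gr i j = tor_dim F i j.
Proof.
rewrite /betti => grM; case: pselect => [exF|[]]; last by exists F.
by apply/eqP; rewrite eqn_leq !tor_dim_le.
Qed.

(** When all differentials vanish modulo the variables, homology is everything,
    so Tor is counted by the generators. *)
Lemma tor_dim_minimal (F : free_resolution gr) i j :
  (forall l, mx_at0 (fr_diff F l) = 0) ->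
  tor_dim F i j = #|[pred a : 'I_(fr_rank F i) | fr_deg a == j]|.
Proof.
move=> min; rewrite /tor_dim /tensor_boundaries [tensor_diff F i]min mulmx0.
rewrite mxrank0 subn0 -(rank_pred_mx K) -[diag_mx _]/(tensor_comp F i j).
case: i => [|i] //=; apply: eqmx_rank.
rewrite capmxSl sub_capmx submx_refl sub_kermx [tensor_diff F i]min mulmx0.
exact: eqxx.
Qed.

End Comparison.

(** * Divisibility by a monomial *)

Section MonomialPoly.
Local Open Scope ring_scope.
Variables (R : comNzRingType) (N : nat).

Lemma mpolyX_dvd (m : 'X_{1..N}) (p : {mpoly R[N]}) :
  (forall u, p@_u != 0 -> (m <= u)%MM) -> exists r, p = r * 'X_[m].
Proof.
move=> h; exists (\sum_(u <- msupp p) p@_u *: 'X_[u - m]).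
rewrite [LHS]mpolyE mulr_suml; apply: eq_big_seq => u.
by rewrite mcoeff_msupp -scalerAl -mpolyXD => /h /submK ->.
Qed.

Lemma mcoeffMX_neq0 (m u : 'X_{1..N}) (r : {mpoly R[N]}) :
  (r * 'X_[m])@_u != 0 -> (m <= u)%MM.
Proof.
case/mcoeffM_neq0 => u1 [u2 [_ + ->]]; rewrite mcoeffX.
by case: (eqVneq m u2) => [<- _|_]; rewrite ?lem_addl // mulr0n eqxx.
Qed.

End MonomialPoly.

(** * The chain complex of the full simplex *)

Section Simplex.
Local Open Scope ring_scope.
Variables (R : nzRingType) (T : finType).
Implicit Types (A B : {set T}) (s t : T) (p : {set T} -> R).

(** The position of t in A with respect to the enumeration of T, or where t
    would be inserted in A; its parity is the sign of the face without t. *)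
Definition pos t A := #|[set s in A | (enum_rank s < enum_rank t)%N]|.

Lemma posU1 s t A : s \notin A ->
  pos t (s |: A) = ((enum_rank s < enum_rank t)%N + pos t A)%N.
Proof.
move=> sA; rewrite /pos; have [lt|ge] := boolP (enum_rank s < enum_rank t)%N.
  rewrite (_ : [set _ in _ | _] =
    s |: [set r in A | (enum_rank r < enum_rank t)%N]).
    by rewrite cardsU1 !inE (negbTE sA).
  by apply/setP => r; rewrite !inE; case: eqP => [->|].
rewrite add0n; apply: eq_card => r; rewrite !inE; case: eqP => [->|//].
by rewrite (negbTE sA) (negbTE ge).
Qed.

Lemma pos_swap s t A : s \notin A -> t \notin A -> s != t ->
  (-1) ^+ pos s A * (-1) ^+ pos t (s |: A) =
  - ((-1) ^+ pos t A * (-1) ^+ pos s (t |: A)) :> R.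
Proof.
move=> sA tA st; rewrite !posU1 // -!exprD.
case: ltngtP => [_|_|/val_inj/enum_rank_inj/eqP]; last by rewrite (negbTE st).
  by rewrite add1n add0n addnS exprS mulN1r addnC.
by rewrite add1n add0n addnS exprS mulN1r opprK addnC.
Qed.

(** A chain is encoded by its coefficient p A on each face A, the empty face
    included, so that the complex is augmented. *)
Definition simplex_bd p B := \sum_(t | t \notin B) (-1) ^+ pos t B * p (t |: B).

(** The terms removing s and then t cancel those removing t and then s. They
    are paired by swapping the two indices rather than by an antisymmetry
    argument, which would fail in characteristic 2. *)
Lemma simplex_bd_bd p B : simplex_bd (simplex_bd p) B = 0.
Proof.
rewrite /simplex_bd; under eq_bigr do rewrite big_distrr /=.
rewrite pair_big_dep /=.
rewrite (bigID (fun x => enum_rank x.1 < enum_rank x.2)%N) /=.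
rewrite [X in _ + X](reindex_inj (h := fun x => (x.2, x.1))) /=; last first.
  by move=> [a b] [c d] [-> ->].
rewrite [X in _ + X](eq_bigl (fun x : T * T => [&& x.1 \notin B,
  x.2 \notin x.1 |: B & (enum_rank x.1 < enum_rank x.2)%N])); last first.
  move=> [s t] /=; rewrite !inE !negb_or -leqNgt (eq_sym t).
  case: (eqVneq s t) => [->|st]; rewrite ?andbF //=.
  have : enum_rank s != enum_rank t by rewrite (inj_eq enum_rank_inj).
  rewrite -val_eqE /= => h; rewrite leq_eqVlt (negbTE h) /=.
  by case: (s \in B); case: (t \in B).
under [X in X + _]eq_bigl do rewrite -andbA.
rewrite -big_split big1 //= => -[s t] /= /and3P[sB]; rewrite !inE negb_or.
case/andP=> ts tB _; rewrite !mulrA.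
by rewrite (pos_swap sB tB) 1?eq_sym // mulNr setUCA addNr.
Qed.

Variable Q : T -> {additive R -> R}.

(** The simplex is a cone over each of its vertices. Here the apex varies:
    Q t extracts the part of a coefficient that is to be coned from t. *)
Definition simplex_cone p B := \sum_(t in B) (-1) ^+ pos t B * Q t (p (B :\ t)).

(** For a single apex this is the usual contraction of a cone. The terms where
    the removed and the added vertex differ cancel by the sign rule; those where
    they agree give Q t (p B), once for t outside B (cone, then remove t) and
    once for t in B (remove t, then cone). *)
Lemma simplex_cone_homotopy p B :
  simplex_bd (simplex_cone p) B + simplex_cone (simplex_bd p) B =
  \sum_t Q t (p B).
Proof.
(* In both composites, split off the terms in which the vertex added by one
   operator is removed by the other. *)
have -> : simplex_bd (simplex_cone p) B = \sum_(t | t \notin B) Q t (p B) +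
   \sum_(t | t \notin B) \sum_(s in B)
     (-1) ^+ pos t B * ((-1) ^+ pos s (t |: B) * Q s (p ((t |: B) :\ s))).
  rewrite -big_split; apply: eq_bigr => t tB /=.
  rewrite /simplex_cone big_setU1 //= mulrDr; congr (_ + _); last first.
    by rewrite big_distrr.
  rewrite posU1 // ltnn add0n setU1K // mulrA -exprD addnn -mul2n exprM.
  by rewrite sqrrN expr1n expr1n mul1r.
have -> : simplex_cone (simplex_bd p) B = \sum_(s in B) Q s (p B) +
   \sum_(s in B) \sum_(t | t \notin B)
     (-1) ^+ pos s B * ((-1) ^+ pos t (B :\ s) * Q s (p (t |: (B :\ s)))).
  rewrite -big_split; apply: eq_bigr => s sB /=.
  rewrite /simplex_bd (bigD1 s) /= ?setD11 // raddfD mulrDr /=; congr (_ + _).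
    rewrite raddfMsign setD1K // -{1}(setD1K sB) posU1 ?setD11 // ltnn add0n.
    by rewrite mulrA -exprD addnn -mul2n exprM sqrrN expr1n expr1n mul1r.
  rewrite raddf_sum big_distrr /=; apply: eq_big => [t|t _].
    by rewrite !inE; case: eqVneq => [->|]; rewrite ?sB ?andbF ?andbT.
  by rewrite raddfMsign.
rewrite addrACA [RHS](bigID (mem B)) /= [X in X + _]addrC -[RHS]addr0.
congr (_ + _).
rewrite exchange_big -big_split big1 //= => s sB.
rewrite -big_split big1 //= => t tB.
have st : s != t by apply: contraNneq tB => <-.
have -> : (t |: B) :\ s = t |: (B :\ s).
  apply/setP => r; rewrite !inE; case: (eqVneq r s) => [->|//=].
  by rewrite (negbTE st).
rewrite !mulrA -mulrDl [X in X * _](_ : _ = 0) ?mul0r //.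
rewrite -!exprD -{1}(setD1K sB) !posU1 ?setD11 //.
case: ltngtP => [_|_|/val_inj/enum_rank_inj/eqP]; last by rewrite (negbTE st).
  by rewrite add1n add0n exprS mulN1r addnC addNr.
by rewrite add1n add0n addnS exprS mulN1r addnC addNr.
Qed.

End Simplex.

(** * The Taylor complex of a family of monomials *)

Section Taylor.
Local Open Scope ring_scope.
Variables (K : fieldType) (N : nat) (T : finType) (g : T -> 'X_{1..N}).
Local Notation S := {mpoly K[N]}.
Implicit Types (A B : {set T}) (p : {set T} -> S) (u : 'X_{1..N}).

Definition mlcm_set A : 'X_{1..N} := [multinom \max_(t in A) g t v | v < N].

Lemma mlcm_set_leP A u :
  reflect (forall t, t \in A -> (g t <= u)%MM) (mlcm_set A <= u)%MM.
Proof.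
apply: (iffP mnm_lepP) => [h t tA|h v].
  apply/mnm_lepP => v; apply: leq_trans (h v).
  by rewrite mnmE; apply: (bigmax_sup t).
by rewrite mnmE; apply/bigmax_leqP => t /h/mnm_lepP.
Qed.

Lemma mlcm_set0 : mlcm_set finset.set0 = 0%MM.
Proof. by apply/mnmP => v; rewrite mnmE mnm0E big_set0. Qed.

Lemma mlcm_setU1 t A u :
  (mlcm_set (t |: A) <= u)%MM = (g t <= u)%MM && (mlcm_set A <= u)%MM.
Proof.
apply/mlcm_set_leP/andP => [h|[h1 /mlcm_set_leP h2] s].
  split; first by apply: h; rewrite setU11.
  by apply/mlcm_set_leP => s sA; apply: h; rewrite setU1r.
by rewrite !inE => /orP[/eqP->|/h2].
Qed.

(** In multidegree u the Taylor complex is the chain complex of the full simplex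
    on the generators that divide X^u, so any one of them can serve as apex. *)
Definition apex u := [pick t | (g t <= u)%MM].

Definition apex_part t := mrestrict (R := K) (fun u => apex u == Some t).

(** Every monomial that lies in the ideal belongs to exactly one apex part. *)
Lemma sum_apex_part (q : S) : (forall u, q@_u != 0 -> apex u) ->
  \sum_t apex_part t q = q.
Proof.
move=> h; apply/mpolyP => u; rewrite raddf_sum /=.
under eq_bigr do rewrite mcoeff_restrict.
have [->|/h] := eqVneq q@_u 0; first by rewrite big1 // => t _; rewrite if_same.
case: (apex u) => // t _; rewrite (bigD1 t) //= eqxx big1 ?addr0 // => s st.
by case: eqP => // -[e]; rewrite e eqxx in st.
Qed.

Lemma monomial_idealP (q : S) :
  (exists c : T -> S, q = \sum_t c t * 'X_[g t]) <->
  (forall u, q@_u != 0 -> apex u).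
Proof.
split=> [[c ->] u /mcoeff_sum_neq0[t _ /mcoeffMX_neq0 le]|h].
  by rewrite /apex; case: pickP => // /(_ t); rewrite le.
have /choice[c hc] t : exists c, apex_part t q = c * 'X_[g t].
  apply: mpolyX_dvd => u; rewrite mcoeff_restrict; case: ifP; rewrite ?eqxx //.
  by rewrite /apex; case: pickP => // s le /eqP[<-].
by exists c; rewrite -[LHS](sum_apex_part h); apply: eq_bigr => t _.
Qed.

(** The free module in homological degree i has one generator for each i-subset
    A of T, placed in the degree of the least common multiple of A. *)
Definition taylor_sets i : {set {set T}} := [set A : {set T} | #|A| == i].
Definition taylor_rank i := #|taylor_sets i|.
Definition taylor_set i (a : 'I_(taylor_rank i)) : {set T} := enum_val a.
Definition taylor_deg i (a : 'I_(taylor_rank i)) :=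
  mdeg (mlcm_set (taylor_set a)).
Definition taylor_diff i : 'M[S]_(taylor_rank i.+1, taylor_rank i) :=
  \matrix_(a, b)
    \sum_(t | (t \notin taylor_set b) && (t |: taylor_set b == taylor_set a))
      (-1) ^+ pos t (taylor_set b) *
      'X_[mlcm_set (taylor_set a) - mlcm_set (taylor_set b)].

Lemma card_taylor_set i (a : 'I_(taylor_rank i)) : #|taylor_set a| = i.
Proof. by have := enum_valP a; rewrite inE => /eqP. Qed.

(** Sending the generator of A to X^lcm(A) times the face A embeds the Taylor
    complex into the simplex complex with coefficients in S. In the larger
    complex the differential has only signs as coefficients and multidegrees are
    visible as exponents; the image consists of the chains whose coefficient on
    A is divisible by X^lcm(A). *)
Definition simplex_of i (v : 'rV[S]_(taylor_rank i)) A : S :=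
  \sum_(a | taylor_set a == A) v 0 a * 'X_[mlcm_set A].

Lemma simplex_of_set i v (a : 'I_(taylor_rank i)) :
  simplex_of v (taylor_set a) = v 0 a * 'X_[mlcm_set (taylor_set a)].
Proof.
rewrite /simplex_of (bigD1 a) //= big1 ?addr0 // => b /andP[/eqP].
by move=> /enum_val_inj ->; rewrite eqxx.
Qed.

Lemma simplex_of_card i (v : 'rV_(taylor_rank i)) A :
  #|A| != i -> simplex_of v A = 0.
Proof.
move=> h; rewrite /simplex_of big1 // => a /eqP e.
by rewrite -e card_taylor_set eqxx in h.
Qed.

Lemma taylor_setP i A :
  #|A| = i -> exists a : 'I_(taylor_rank i), taylor_set a = A.
Proof.
move=> h; have hA : A \in taylor_sets i by rewrite inE h.
by exists (enum_rank_in hA A); rewrite /taylor_set enum_rankK_in.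
Qed.

Lemma simplex_of_le i (v : 'rV_(taylor_rank i)) A u :
  (simplex_of v A)@_u != 0 -> (mlcm_set A <= u)%MM.
Proof. by rewrite /simplex_of -mulr_suml; exact: mcoeffMX_neq0. Qed.

Lemma mulIX m : injective (fun q : S => q * 'X_[m]).
Proof. by apply: mulIf; rewrite -msupp_eq0 msuppX. Qed.

Lemma simplex_of_inj i (v w : 'rV_(taylor_rank i)) :
  simplex_of v =1 simplex_of w -> v = w.
Proof.
move=> h; apply/rowP => a; have := h (taylor_set a).
by rewrite !simplex_of_set => /mulIX.
Qed.

Lemma simplex_of_exists i p :
  (forall A, #|A| != i -> p A = 0) ->
  (forall A u, (p A)@_u != 0 -> (mlcm_set A <= u)%MM) ->
  exists v : 'rV_(taylor_rank i), simplex_of v =1 p.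
Proof.
move=> hc hle; have /choice[r hr] A := mpolyX_dvd (hle A).
exists (\row_a r (taylor_set a)) => A.
have [|/[dup]/hc -> /simplex_of_card -> //] := eqVneq #|A| i.
by case/taylor_setP => a <-; rewrite simplex_of_set mxE -hr.
Qed.

Lemma simplex_of_diff i (v : 'rV_(taylor_rank i.+1)) :
  simplex_of (v *m taylor_diff i) =1 simplex_bd (simplex_of v).
Proof.
move=> B; have [|nB] := eqVneq #|B| i; last first.
  rewrite simplex_of_card // /simplex_bd big1 // => t tB.
  by rewrite simplex_of_card ?mulr0 // cardsU1 tB.
case/taylor_setP => b <-; rewrite simplex_of_set mxE mulr_suml /simplex_bd.
under [RHS]eq_bigr do rewrite /simplex_of big_distrr /=.
rewrite (exchange_big_dep predT) //=; apply: eq_bigr => a _.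
rewrite mxE mulr_sumr mulr_suml; apply: eq_big => [t|t /andP[_ /eqP e]].
  by rewrite (eq_sym (taylor_set a)).
rewrite -e -mulrA -mulrA -mpolyXD submK ?mulrA.
  by rewrite (mulrC (v _ _)).
apply/mlcm_set_leP => s sb; apply: (mlcm_set_leP _ _ (lepm_refl _)).
exact: setU1r.
Qed.

(** A cycle p whose monomials all have an apex is the boundary of its cone. The
    cone stays inside the Taylor complex: an exponent u in the coefficient of B
    comes from the face B minus t with t dividing X^u, hence lcm(B) divides X^u.
    In the lowest degree the apex condition is membership in the ideal, in
    higher degrees it holds automatically. *)
Lemma taylor_exact i (v : 'rV_(taylor_rank i)) :
  simplex_bd (simplex_of v) =1 (fun=> 0) ->
  (forall A u, (simplex_of v A)@_u != 0 -> apex u) ->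
  exists w, v = w *m taylor_diff i.
Proof.
move=> bd0 hap; set p := simplex_of v.
(* The cone, divided by the monomials X^lcm(B), is the preimage w. *)
pose q := simplex_cone apex_part p.
have [A hA|A u|w hw] := @simplex_of_exists i.+1 q.
- rewrite /q /simplex_cone big1 // => t tA.
  rewrite /p simplex_of_card ?raddf0 ?mulr0 //.
  by apply: contraNneq hA => <-; rewrite (cardsD1 t) tA.
- rewrite /q /simplex_cone => /mcoeff_sum_neq0[t tA /mcoeff_sign_neq0].
  rewrite mcoeff_restrict /apex; case: pickP => [s le|_]; last by rewrite eqxx.
  case: ifP => [/eqP[st] /simplex_of_le le'|_]; last by rewrite eqxx.
  by rewrite -(setD1K tA) mlcm_setU1 -{1}st le le'.
exists w; apply: simplex_of_inj => A; rewrite simplex_of_diff.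
rewrite -/p -[p A]sum_apex_part; last by move=> u /hap.
rewrite -(simplex_cone_homotopy apex_part) [X in _ + X]big1 ?addr0; last first.
  by move=> t tA; rewrite bd0 raddf0 mulr0.
by rewrite /simplex_bd; apply: eq_bigr => t _; rewrite hw.
Qed.

End Taylor.

(** * Gradings of a monomial ideal and of its quotient *)

Section MonomialIdeal.
Local Open Scope ring_scope.
Local Open Scope quotient_scope.
Variables (K : fieldType) (N : nat) (T : finType) (g : T -> 'X_{1..N}).
Local Notation S := {mpoly K[N]}.
Variable G : T -> S.
Hypothesis G_monomial : forall t, G t = 'X_[g t].

Lemma mem_monomial_ideal (q : S) :
  (q : S^o) \in ideal_gen G <-> (forall u, q@_u != 0 -> apex g u).
Proof.
rewrite -(monomial_idealP g q) inE; split=> [/asboolP[c ->]|[c ->]].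
  by exists c; under eq_bigr do rewrite G_monomial.
by apply/asboolP; exists c; under [RHS]eq_bigr do rewrite G_monomial.
Qed.

Lemma mrestrict_monomial_ideal P (q : S) :
  (q : S^o) \in ideal_gen G -> (mrestrict P q : S^o) \in ideal_gen G.
Proof.
move=> /mem_monomial_ideal h; apply/mem_monomial_ideal => u.
by rewrite mcoeff_restrict; case: (P u); rewrite ?eqxx //; exact: h.
Qed.

Definition quot_gr d : set (quot_mod G) :=
  [set \pi_(quot_mod G) p | p in [set p : S | p \is d.-homog]].
Definition ideal_gr d : set (ideal_mod G) := [set p | ideal_val p \is d.-homog].

Lemma quot_pi_eq0 (q : S^o) : \pi_(quot_mod G) q = 0 <-> q \in ideal_gen G.
Proof.
have -> : 0 = \pi_(quot_mod G) 0.
  by rewrite -[X in _ = _ X](scale0r (0 : S^o)) pi_quotZ scale0r.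
split=> [/eqP|h]; first by rewrite -Quotient.idealrBE subr0.
by apply/eqP; rewrite -Quotient.idealrBE subr0.
Qed.

(** The degree components descend to the quotient because a monomial ideal is
    stable under restriction to any set of monomials. *)
Lemma quot_graded : graded quot_gr.
Proof.
pose pr d (m : quot_mod G) : quot_mod G :=
  \pi_(quot_mod G) (mrestrict (fun u => mdeg u == d) (repr m) : S^o).
have pr_pi d (q : S^o) : pr d (\pi_(quot_mod G) q) =
    \pi_(quot_mod G) (mrestrict (fun u => mdeg u == d) q : S^o).
  apply/eqP; rewrite -Quotient.idealrBE -[_ - _]raddfB /=.
  by apply: mrestrict_monomial_ideal; rewrite Quotient.idealrBE reprK.
have piB (p q : S^o) : \pi_(quot_mod G) p - \pi_(quot_mod G) q =
   \pi_(quot_mod G) (p - q).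
  by rewrite -scaleN1r -pi_quotZ -pi_quotD scaleN1r.
exists pr; split=> [d m m'|d e p m [q /= /dhomogP hq <-]].
  elim/quot_modP: m => q; elim/quot_modP: m' => q'.
  by rewrite piB !pr_pi piB raddfB.
rewrite -pi_quotZ pr_pi -pi_quotZ; congr (\pi_(quot_mod G) _).
apply: mrestrictM => u v; rewrite -mcoeff_msupp => /hq/= <-.
by rewrite mdegD.
Qed.

Lemma ideal_graded : graded ideal_gr.
Proof.
pose pr d (m : ideal_mod G) : ideal_mod G :=
  IdealMod (mrestrict_monomial_ideal (fun u => mdeg u == d) (valP m)).
exists pr; split=> [d m m'|d e p m /dhomogP hq]; apply: val_inj => /=.
  exact: mrestrict_is_additive.
apply: (@mrestrictM _ _ _ _ p (ideal_val m : S)) => u v.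
rewrite -mcoeff_msupp => /hq/= <-.
by rewrite mdegD.
Qed.

End MonomialIdeal.

(** * Taylor resolutions and Betti numbers of monomial ideals *)

Section TaylorResolution.
Local Open Scope ring_scope.
Local Open Scope quotient_scope.
Variables (K : fieldType) (N : nat) (T : finType) (g : T -> 'X_{1..N}).
Local Notation S := {mpoly K[N]}.
Variable G : T -> S.
Hypothesis G_monomial : forall t, G t = 'X_[g t].
Local Notation L := (@mlcm_set N T g).
Local Notation diff := (@taylor_diff K N T g).
Local Notation tdeg := (@taylor_deg N T g).

Lemma taylor_diff_neq0 i a b u : (diff i a b)@_u != 0 ->
  taylor_set b \subset taylor_set a /\
  u = (L (taylor_set a) - L (taylor_set b))%MM.
Proof.
rewrite mxE => /mcoeff_sum_neq0[t /andP[_ /eqP <-]] /mcoeff_sign_neq0.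
by rewrite mcoeffX subsetUr; case: (eqVneq _ u) => [<-|]; rewrite ?mulr0n ?eqxx.
Qed.

Lemma mlcm_setS (A B : {set T}) : B \subset A -> (L B <= L A)%MM.
Proof.
move=> /fintype.subsetP BA; apply/mlcm_set_leP => t /BA.
exact: (mlcm_set_leP _ _ _ (lepm_refl _)).
Qed.

Lemma taylor_diff_homog_mx i : homog_mx (@tdeg i.+1) (@tdeg i) (diff i).
Proof.
move=> a b u /taylor_diff_neq0[/mlcm_setS le ->].
by rewrite -mdegD submK.
Qed.

Lemma taylor_diff_homog i (a : 'I_(taylor_rank T i.+1))
    (b : 'I_(taylor_rank T i)) :
  if (tdeg b <= tdeg a)%N then diff i a b \is (tdeg a - tdeg b)%N.-homog
  else diff i a b == 0.
Proof.
have h := @taylor_diff_homog_mx i a b; case: leqP => [le|lt].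
  by apply/dhomogP => u; rewrite mcoeff_msupp => /h/= <-; rewrite addnK.
apply/eqP/mpolyP => u; rewrite mcoeff0; apply/eqP/negPn/negP => /h e.
by move: lt; rewrite -e ltnNge leq_addl.
Qed.

Lemma taylor_diff_exact i (v : 'rV[S]_(taylor_rank T i.+1)) :
  v *m diff i = 0 <-> exists w, v = w *m diff i.+1.
Proof.
split=> [v0|[w ->]].
  apply: taylor_exact => [A|A u /[dup] nz /simplex_of_le /mlcm_set_leP le].
    rewrite -simplex_of_diff v0 /simplex_of big1 // => a _.
    by rewrite mxE mul0r.
  have [A0|[t tA]] := set_0Vmem A.
    by move: nz; rewrite simplex_of_card ?mcoeff0 ?eqxx // A0 cards0.
  rewrite /apex; case: pickP => // /(_ t).
  by rewrite le.
apply: (@simplex_of_inj K N T g) => A; rewrite simplex_of_diff.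
have -> : simplex_of g (0 : 'rV[S]_(taylor_rank T i)) A = 0.
  by rewrite /simplex_of big1 // => a _; rewrite mxE mul0r.
rewrite -[RHS](simplex_bd_bd (simplex_of g w) A).
by apply: eq_bigr => t _; rewrite simplex_of_diff.
Qed.

(** The common formula of both augmentations: on rank 0 it is the identification
    of the free module on the empty set with S, on rank 1 it sends generators to
    the given monomials. *)
Definition taylor_eval i (v : 'rV[S]_(taylor_rank T i)) : S :=
  \sum_a v 0 a * 'X_[L (taylor_set a)].

Lemma taylor_eval_linear i c (v w : 'rV[S]_(taylor_rank T i)) :
  taylor_eval (c *: v + w) = c * taylor_eval v + taylor_eval w.
Proof.
rewrite /taylor_eval big_distrr -big_split; apply: eq_bigr => a _ /=.
by rewrite !mxE mulrDl mulrA.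
Qed.

Lemma taylor_eval0 (v : 'rV[S]_(taylor_rank T 0)) :
  taylor_eval v = simplex_of g v finset.set0.
Proof.
rewrite /simplex_of /taylor_eval; apply: eq_big => a.
  by rewrite -cards_eq0 card_taylor_set.
move=> _; congr (_ * 'X_[L _]); apply/eqP.
by rewrite -cards_eq0 card_taylor_set.
Qed.

Lemma taylor_eval1 (v : 'rV[S]_(taylor_rank T 1)) :
  taylor_eval v = \sum_t simplex_of g v [set t].
Proof.
rewrite /simplex_of /taylor_eval (exchange_big_dep predT) //=.
apply: eq_bigr => a _; have /eqP/cards1P[t ->] := card_taylor_set a.
rewrite (big_pred1 t) // => s.
by rewrite /= eq_sym (inj_eq set1_inj).
Qed.

Lemma taylor_eval_diff0 (v : 'rV[S]_(taylor_rank T 1)) :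
  taylor_eval (v *m diff 0) = taylor_eval v.
Proof.
rewrite taylor_eval0 simplex_of_diff taylor_eval1 /simplex_bd.
apply: eq_big => [t|t _]; first by rewrite inE.
rewrite setU0 [pos _ _](_ : _ = 0%N) ?mul1r //.
by apply/eqP; rewrite cards_eq0; apply/eqP/setP => s; rewrite !inE.
Qed.

Lemma taylor_eval0_eq0 (v : 'rV[S]_(taylor_rank T 0)) :
  taylor_eval v = 0 -> v = 0.
Proof.
move=> h; apply: (@simplex_of_inj K N T g) => A.
have [/cards0_eq ->|nA] := eqVneq #|A| 0%N; last by rewrite !simplex_of_card.
rewrite -!taylor_eval0 h /taylor_eval big1 // => a _.
by rewrite mxE mul0r.
Qed.

Lemma taylor_eval1_ideal (q : S) :
  (q : S^o) \in ideal_gen G <->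
  exists v : 'rV[S]_(taylor_rank T 1), taylor_eval v = q.
Proof.
rewrite inE; split=> [/asboolP[c ->]|[v <-]].
  have /choice[f hf] t := @taylor_setP T 1 _ (cards1 t).
  exists (\row_a \sum_(t | f t == a) c t).
  rewrite /taylor_eval; under eq_bigr do rewrite mxE mulr_suml.
  rewrite (exchange_big_dep predT) //=; apply: eq_bigr => t _.
  rewrite (big_pred1 (f t)) => [|a]; last by rewrite /= eq_sym.
  rewrite hf G_monomial; congr (_ * 'X_[_]); apply/mnmP => i.
  by rewrite mnmE big_set1.
apply/asboolP; rewrite taylor_eval1.
have /choice[c hc] t : exists c, simplex_of g v [set t] = c * 'X_[g t].
  apply: mpolyX_dvd => u /simplex_of_le/mlcm_set_leP; apply.
  by rewrite inE.
by exists c; apply: eq_bigr => t _; rewrite hc G_monomial.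
Qed.

Lemma taylor_delta_eval i a :
  taylor_eval (delta_mx 0 a : 'rV[S]_(taylor_rank T i)) = 'X_[L (taylor_set a)].
Proof.
rewrite /taylor_eval (bigD1 a) //= mxE !eqxx mul1r big1 ?addr0 // => b ba.
by rewrite mxE eqxx (negbTE ba) mul0r.
Qed.

Definition quot_aug (v : 'rV[S]_(taylor_rank T 0)) : quot_mod G :=
  \pi_(quot_mod G) (taylor_eval v : S^o).

Lemma quot_aug_linear : linear quot_aug.
Proof.
move=> c v w; rewrite /quot_aug taylor_eval_linear.
by rewrite -pi_quotZ -pi_quotD.
Qed.
HB.instance Definition _ :=
  GRing.isLinear.Build S _ _ _ quot_aug quot_aug_linear.

Lemma quot_aug_homog (a : 'I_(taylor_rank T 0)) :
  @quot_gr _ _ _ G (tdeg a) (quot_aug (delta_mx 0 a)).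
Proof.
exists 'X_[L (taylor_set a)]; first by rewrite /= dhomogX.
by rewrite /quot_aug taylor_delta_eval.
Qed.

Lemma quot_aug_surj (m : quot_mod G) : exists v, quot_aug v = m.
Proof.
elim/quot_modP: m => q.
have [a ha] := @taylor_setP T 0 finset.set0 (cards0 _).
exists ((q : S) *: delta_mx 0 a); rewrite /quot_aug; congr (\pi_(quot_mod G) _).
rewrite -[_ *: _]addr0 taylor_eval_linear taylor_delta_eval ha mlcm_set0.
rewrite mpolyX0 mulr1 /taylor_eval big1 ?addr0 // => b _.
by rewrite mxE mul0r.
Qed.

Lemma quot_aug_exact (v : 'rV_(taylor_rank T 0)) :
  quot_aug v = 0 <-> exists w, v = w *m diff 0.
Proof.
rewrite quot_pi_eq0 taylor_eval1_ideal; split=> -[w hw]; exists w.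
  apply/eqP; rewrite -subr_eq0; apply/eqP/taylor_eval0_eq0.
  rewrite -scaleN1r addrC taylor_eval_linear taylor_eval_diff0 hw mulN1r.
  exact: addNr.
by rewrite hw taylor_eval_diff0.
Qed.

Definition quot_resolution : free_resolution (@quot_gr _ _ _ G) :=
  @FreeResolution K N (quot_mod G) (@quot_gr _ _ _ G)
    (taylor_rank T) (@tdeg) diff quot_aug taylor_diff_homog quot_aug_homog
    quot_aug_surj quot_aug_exact taylor_diff_exact.

Definition ideal_aug (v : 'rV[S]_(taylor_rank T 1)) : ideal_mod G :=
  IdealMod (proj2 (taylor_eval1_ideal (taylor_eval v)) (ex_intro _ v erefl)).

Lemma ideal_aug_linear : linear ideal_aug.
Proof. by move=> c v w; apply: val_inj; exact: taylor_eval_linear. Qed.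
HB.instance Definition _ :=
  GRing.isLinear.Build S _ _ _ ideal_aug ideal_aug_linear.

Lemma ideal_aug_homog (a : 'I_(taylor_rank T 1)) :
  ideal_gr (tdeg a) (ideal_aug (delta_mx 0 a)).
Proof. by rewrite /ideal_gr /= taylor_delta_eval dhomogX. Qed.

Lemma ideal_aug_surj (m : ideal_mod G) : exists v, ideal_aug v = m.
Proof.
have [v hv] := proj1 (taylor_eval1_ideal _) (valP m).
by exists v; apply: val_inj.
Qed.

Lemma ideal_aug_exact (v : 'rV_(taylor_rank T 1)) :
  ideal_aug v = 0 <-> exists w, v = w *m diff 1.
Proof.
rewrite -taylor_diff_exact; split=> h.
  apply: taylor_eval0_eq0; rewrite taylor_eval_diff0.
  exact: (congr1 (@ideal_val _ _ _) h).
apply: val_inj; rewrite /= -taylor_eval_diff0 h.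
by rewrite /taylor_eval big1 // => b _; rewrite mxE mul0r.
Qed.

(** Dropping the term S of the resolution of S / I and shifting by one leaves a
    resolution of I; this is why the two Betti tables differ by a shift. *)
Definition ideal_resolution : free_resolution (@ideal_gr _ _ _ G) :=
  @FreeResolution K N (ideal_mod G) (@ideal_gr _ _ _ G)
    (fun i => taylor_rank T i.+1) (fun i => @tdeg i.+1) (fun i => diff i.+1)
    ideal_aug (fun i => @taylor_diff_homog i.+1) ideal_aug_homog ideal_aug_surj
    ideal_aug_exact (fun i => @taylor_diff_exact i.+1).

Hypothesis L_strict : forall (A : {set T}) t, t \in A -> L (A :\ t) <> L A.

(** The entries are signed quotients of least common multiples, and these are
    nontrivial monomials as soon as every element matters for the lcm. *)
Lemma taylor_diff_minimal i : mx_at0 (diff i) = 0.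
Proof.
apply/matrixP => a b; rewrite !mxE meval0_coeff raddf_sum big1 // => t.
case/andP=> tb /eqP e; apply/eqP/negPn/negP => /mcoeff_sign_neq0.
rewrite mcoeffX.
have ta : t \in taylor_set a by rewrite -e setU11.
have bE : taylor_set b = taylor_set a :\ t by rewrite -e setU1K.
have le : (L (taylor_set b) <= L (taylor_set a))%MM.
  by apply: mlcm_setS; rewrite bE subD1set.
case: (eqVneq _ 0%MM) => [z _|_]; last by rewrite mulr0n eqxx.
case: (L_strict ta); rewrite -bE -[RHS](submK le) z.
by apply/mnmP => v; rewrite mnmDE mnm0E.
Qed.

(** The number of Taylor generators of degree j in homological degree i. *)
Definition lcm_count i j :=
  #|[set A : {set T} | (#|A| == i) && (mdeg (L A) == j)]|.

Lemma card_taylor_deg i j :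
  #|[pred a : 'I_(taylor_rank T i) | tdeg a == j]| = lcm_count i j.
Proof.
rewrite /lcm_count -!sum1_card [RHS](eq_bigl (fun A =>
  (A \in taylor_sets T i) && (mdeg (L A) == j))).
  rewrite [RHS]big_mkcondr [LHS]big_mkcond [RHS]big_enum_val /=.
  by apply: eq_bigr => a _; rewrite inE.
by move=> A; rewrite !inE.
Qed.

Lemma betti_quot_monomial i j : betti (@quot_gr _ _ _ G) i j = lcm_count i j.
Proof.
rewrite (bettiE quot_resolution) ?tor_dim_minimal ?card_taylor_deg //.
  exact: taylor_diff_minimal.
exact: quot_graded G_monomial.
Qed.

Lemma betti_ideal_monomial i j :
  betti (@ideal_gr _ _ _ G) i j = lcm_count i.+1 j.
Proof.
rewrite (bettiE ideal_resolution) ?tor_dim_minimal ?card_taylor_deg //.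
  by move=> l; exact: taylor_diff_minimal.
exact: ideal_graded G_monomial.
Qed.

End TaylorResolution.

(** * Least common multiples of path monomials *)

Section PathMonomials.
Local Open Scope ring_scope.
Variables (K : fieldType) (k n : nat).
Implicit Types (A : {set leaf k n}) (w : leaf k n).

Definition path_mnm w : 'X_{1..#|edge k n|} :=
  [multinom (enum_val v \in root_path w : nat) | v < #|edge k n|].

Lemma path_monomialE w : path_monomial K w = 'X_[path_mnm w].
Proof.
rewrite mpolyXE_id /path_monomial big_mkcond /=.
rewrite (reindex_onto enum_val enum_rank) /=.
  apply: eq_big => [v|v _]; first by rewrite enum_valK eqxx.
  by rewrite mnmE enum_valK; case: (_ \in _); rewrite ?expr1 ?expr0.
by move=> e _; rewrite enum_rankK.
Qed.

Lemma bigmax_bool (I : finType) (P : pred I) (b : I -> bool) :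
  \max_(i | P i) (b i : nat) = [exists (i | P i), b i] :> nat.
Proof.
case: existsP => [[i /andP[Pi bi]]|h].
  apply/eqP; rewrite eqn_leq; apply/andP; split.
    by apply/bigmax_leqP => j _; case: (b j).
  by apply: (bigmax_sup i); rewrite // bi.
apply/eqP; rewrite -leqn0; apply/bigmax_leqP => i Pi.
by case bi: (b i) => //; case: h; exists i; rewrite Pi.
Qed.

(** The number of edges on the paths from the root to the leaves in A, as
    forest_sizeE shows. *)
Definition forest_size A := mdeg (mlcm_set path_mnm A).

Lemma forest_sizeE A : forest_size A =
  (\sum_(e : edge k n) [exists w in A, prefix (tagged e) w])%N.
Proof.
rewrite /forest_size mdegE.
rewrite [RHS](reindex_onto enum_val enum_rank) /=; last first.
  by move=> e _; rewrite enum_rankK.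
apply: eq_big => [v|v _]; first by rewrite enum_valK eqxx.
rewrite mnmE; under eq_bigr do rewrite mnmE.
rewrite bigmax_bool; congr (nat_of_bool _); apply: eq_existsb => w.
by rewrite inE.
Qed.

End PathMonomials.

(** The edge ending at the leaf w lies on no other path, so removing w from A
    removes the corresponding variable from the lcm. There is such an edge
    because the depth is positive. *)
Lemma path_mlcm_strict k n (A : {set leaf k n.+1}) w : w \in A ->
  mlcm_set (@path_mnm k n.+1) (A :\ w) <> mlcm_set (@path_mnm k n.+1) A.
Proof.
move=> wA eA.
pose e : edge k n.+1 := Tagged (fun l : 'I_n.+1 => l.+1.-tuple 'I_k)
  (w : (@ord_max n).+1.-tuple 'I_k).
have := congr1 (fun m : 'X_{1..#|edge k n.+1|} => m (enum_rank e)) eA.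
rewrite !mnmE; under eq_bigr do rewrite mnmE enum_rankK.
under [in RHS]eq_bigr do rewrite mnmE enum_rankK.
rewrite !bigmax_bool; have -> : [exists w' in A, e \in root_path w'].
  by apply/existsP; exists w; rewrite wA inE prefix_refl.
case: existsP => // -[w' /andP[]]; rewrite !inE => /andP[/negP w'w _].
by rewrite prefixE size_tuple take_oversize ?size_tuple.
Qed.

Section Levels.
Variable k : nat.

(** The vertices at distance l from the root that lie above a leaf of A. For
    positive l they stand for the edges ending there; the level 0 only records
    whether A is nonempty, which makes the recursion uniform in l. *)
Definition level_size n l (A : {set n.-tuple 'I_k}) :=
  \sum_(e : l.-tuple 'I_k) [exists w in A, prefix e w].

Definition subtree n (A : {set n.+1.-tuple 'I_k}) c : {set n.-tuple 'I_k} :=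
  [set w : n.-tuple 'I_k | cons_tuple c w \in A].

Lemma big_tuple_cons (R : Type) (idx : R) (op : Monoid.com_law idx) n
    (F : n.+1.-tuple 'I_k -> R) :
  \big[op/idx]_w F w = \big[op/idx]_c \big[op/idx]_w F (cons_tuple c w).
Proof.
rewrite pair_bigA /=.
rewrite (reindex (fun x : 'I_k * n.-tuple 'I_k => cons_tuple x.1 x.2)) //=.
exists (fun w => (thead w, [tuple of behead w])) => [[c w] _|w _].
  by congr (_, _); apply: val_inj.
by rewrite [RHS]tuple_eta.
Qed.

Lemma exists_subtree n (A : {set n.+1.-tuple 'I_k}) (P : pred (seq 'I_k)) :
  [exists w in A, P w] = [exists c, [exists w in subtree A c, P (c :: w)]].
Proof.
apply/existsP/existsP => [[w /andP[wA Pw]]|[c /existsP[w /andP[]]]].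
  exists (thead w); apply/existsP; exists [tuple of behead w].
  rewrite inE -[X in X \in A](_ : w = _) ?wA; last first.
    by rewrite [LHS]tuple_eta; apply: val_inj.
  by rewrite -[X in P X](_ : tval w = _) // {1}[w]tuple_eta.
by rewrite inE => wA Pw; exists (cons_tuple c w); rewrite wA.
Qed.

Lemma level_size0 n (A : {set n.-tuple 'I_k}) : level_size 0 A = (A != set0).
Proof.
rewrite /level_size (big_pred1 [tuple]) => [|e]; last first.
  by apply/esym/eqP/val_inj; case: e => -[].
congr (nat_of_bool _).
apply/existsP/set0Pn => [[w /andP[]]|[w wA]]; exists w => //.
by rewrite wA prefix0s.
Qed.

Lemma level_sizeS n l (A : {set n.+1.-tuple 'I_k}) :
  level_size l.+1 A = \sum_c level_size l (subtree A c).
Proof.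
rewrite /level_size big_tuple_cons; apply: eq_bigr => c _.
apply: eq_bigr => e _.
congr (nat_of_bool _); rewrite (exists_subtree A (prefix (c :: e))).
apply/existsP/existsP => [[d /existsP[w /andP[wA]]]|[w wA]].
  by rewrite prefix_cons => /andP[/eqP -> h]; exists w; rewrite wA.
by exists c; apply/existsP; exists w; rewrite prefix_cons eqxx.
Qed.

Lemma forest_size_levels n (A : {set leaf k n}) :
  forest_size A = \sum_(l < n) level_size l.+1 A.
Proof.
rewrite forest_sizeE /level_size sig_big_dep /=.
by apply: eq_bigl.
Qed.

(** Each subtree hanging below the root that meets A contributes its own edges
    plus the edge joining it to the root. *)
Lemma forest_sizeS n (A : {set leaf k n.+1}) :
  forest_size A = \sum_c ((subtree A c != set0) + forest_size (subtree A c)).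
Proof.
rewrite forest_size_levels big_ord_recl level_sizeS.
under eq_bigr do rewrite level_size0.
under [X in _ + X]eq_bigr do rewrite level_sizeS.
rewrite exchange_big -big_split; apply: eq_bigr => c _.
by rewrite forest_size_levels.
Qed.

Lemma card_subtree n (A : {set leaf k n.+1}) : #|A| = \sum_c #|subtree A c|.
Proof.
rewrite -sum1_card big_mkcond big_tuple_cons; apply: eq_bigr => c _.
by rewrite -sum1_card [RHS]big_mkcond; apply: eq_bigr => w _; rewrite inE.
Qed.

Definition graft n (f : {ffun 'I_k -> {set leaf k n}}) : {set leaf k n.+1} :=
  [set w : leaf k n.+1 | [tuple of behead w] \in f (thead w)].

Lemma subtree_graft n (f : {ffun 'I_k -> {set leaf k n}}) c :
  subtree (graft f) c = f c.
Proof.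
apply/setP => w; rewrite !inE /= -[X in X \in _](_ : w = _) ?theadE //.
by apply: val_inj.
Qed.

Lemma graft_bij n : bijective (@graft n).
Proof.
exists (fun A => [ffun c => subtree A c]) => [f|A].
  by apply/ffunP => c; rewrite ffunE subtree_graft.
apply/setP => w; rewrite inE ffunE inE; congr (_ \in A).
by rewrite [RHS]tuple_eta; apply: val_inj.
Qed.

End Levels.

(** * The counting recursion *)

Section Bimonomial.
Local Open Scope ring_scope.

(** The monomial x^a y^b. Coefficients in nat suffice, as only counting is
    done. *)
Definition bimonomial (a b : nat) : {poly {poly nat}} := ('X^b)%:P * 'X^a.

Lemma prod_bimonomial (I : finType) (a b : I -> nat) :
  \prod_t bimonomial (a t) (b t) = bimonomial (\sum_t a t)%N (\sum_t b t)%N.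
Proof.
elim/big_rec3: _ => [|t b' a' p _ ->].
  by rewrite /bimonomial !expr0 mulr1.
by rewrite /bimonomial !exprD polyCM mulrACA.
Qed.

Lemma coef_bimonomial a b i j :
  ((bimonomial a b)`_i)`_j = ((a == i) && (b == j)) :> nat.
Proof.
rewrite /bimonomial coefCM coefXn; case: (eqVneq a i) => _; last first.
  by rewrite mulr0 coef0.
by rewrite mulr1 coefXn eq_sym; case: (_ == _).
Qed.

End Bimonomial.

Lemma prod_bool (I : finType) (b : I -> bool) :
  \prod_t (b t : nat) = [forall t, b t] :> nat.
Proof.
case: forallP => [h|h]; first by rewrite big1 // => t _; rewrite h.
have [t /negbTE bt] : exists t, ~~ b t.
  by apply/existsP; rewrite -negb_forall; apply/forallP.
by rewrite (bigD1 t) //= bt.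
Qed.

(** The only tuple a that contributes is x itself, provided that x fits in the
    bounded type of entries; whenever Q can hold this follows from the second
    hypothesis. *)
Lemma sum_profile s m (x : 'I_s -> nat) (Q : pred {ffun 'I_s -> 'I_m.+1})
    (q : bool) :
  (forall a : {ffun 'I_s -> 'I_m.+1},
     (forall t, a t = x t :> nat) -> Q a = q) ->
  (q -> forall t, x t <= m) ->
  \sum_(a : {ffun 'I_s -> 'I_m.+1} | Q a) \prod_(t < s) (x t == a t) = q.
Proof.
move=> Qq; under eq_bigr do rewrite prod_bool.
case: q Qq => Qq le; last first.
  rewrite big1 // => a Qa; case: forallP => // h.
  by rewrite Qq // in Qa => t; rewrite (eqP (h t)).
pose a0 : {ffun 'I_s -> 'I_m.+1} := [ffun t => inord (x t)].
have a0E t : a0 t = x t :> nat by rewrite ffunE inordK // ltnS le.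
rewrite (bigD1 a0) /=; last exact: Qq.
rewrite [nat_of_bool _](_ : _ = 1%N); last first.
  by case: forallP => // -[] t; rewrite a0E.
rewrite big1 // => a /andP[_ /eqP ne]; case: forallP => // h; case: ne.
by apply/ffunP => t; apply: val_inj; rewrite /= a0E (eqP (h t)).
Qed.

Section Recursion.
Variable k : nat.

Local Notation count n := (lcm_count (@path_mnm k n)).

Section GeneratingFunction.
Local Open Scope ring_scope.

Definition forest_gf n : {poly {poly nat}} :=
  \sum_(A : {set leaf k n}) bimonomial #|A| (forest_size A).

(** Nonempty leaf sets of the tree of depth n, with the additional edge that
    joins this tree to a new root. *)
Definition planted_gf n : {poly {poly nat}} :=
  \sum_(A : {set leaf k n} | A != finset.set0)
    bimonomial #|A| (forest_size A).+1.

Lemma coef_forest_gf n i j : ((forest_gf n)`_i)`_j = count n i j.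
Proof.
rewrite /forest_gf !coef_sum /lcm_count -sum1_card [RHS]big_mkcond /=.
by apply: eq_bigr => A _; rewrite coef_bimonomial inE; case: (_ && _).
Qed.

Lemma forest_size0 n : forest_size (finset.set0 : {set leaf k n}) = 0%N.
Proof. by rewrite /forest_size mlcm_set0 mdeg0. Qed.

(** A set of leaves of the deeper tree is an independent choice, for each of the
    k children of the root, of nothing or of a nonempty set of leaves below. *)
Lemma forest_gfS n : forest_gf n.+1 = (planted_gf n + 1) ^+ k.
Proof.
rewrite /forest_gf (reindex (@graft k n)) /=; last first.
  by apply: onW_bij; exact: graft_bij.
under eq_bigr => f _.
  rewrite card_subtree forest_sizeS -prod_bimonomial.
  under eq_bigr do rewrite !subtree_graft.
  over.
rewrite -(bigA_distr_bigA (fun (c : 'I_k) (A : {set leaf k n}) =>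
  bimonomial #|A| ((A != finset.set0) + forest_size A)%N)) /=.
rewrite prodr_const card_ord (bigD1 finset.set0) //=; congr (_ ^+ _).
rewrite [RHS]addrC; congr (_ + _); last by apply: eq_bigr => A ->.
by rewrite eqxx cards0 forest_size0 /bimonomial !expr0 mulr1.
Qed.

Lemma planted_gfX n s : planted_gf n ^+ s =
  \sum_(f : {ffun 'I_s -> {set leaf k n}} | [forall t, f t != finset.set0])
    bimonomial (\sum_t #|f t|)%N (\sum_t forest_size (f t) + s)%N.
Proof.
rewrite -[in LHS](card_ord s) -prodr_const bigA_distr_big /=.
apply: eq_big => f; first by apply/ffun_onP/forallP.
move=> _; rewrite prod_bimonomial; congr (bimonomial _ _).
under eq_bigr do rewrite -addn1.
by rewrite big_split /= sum1_card card_ord.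
Qed.

End GeneratingFunction.

Lemma coef_planted_gfX n s i j : (((planted_gf n ^+ s)`_i)`_j)%R =
  \sum_(a in indexA i s) \sum_(b in indexB j s)
    \prod_(t < s) count n (a t) (b t).
Proof.
have countE (a b : nat) : count n a b =
    \sum_(A : {set leaf k n}) (#|A| == a) * (forest_size A == b).
  rewrite /lcm_count -sum1_card big_mkcond; apply: eq_bigr => A _.
  by rewrite inE mulnb; case: (_ && _).
(* Expanding the product of counts into a sum over families f of leaf sets
   turns the profiles a and b into the sizes and edge numbers of the f t. *)
have prodE (a : {ffun 'I_s -> 'I_i.+1}) (b : {ffun 'I_s -> 'I_j.+1}) :
    \prod_(t < s) count n (a t) (b t) = \sum_(f : {ffun 'I_s -> {set leaf k n}})
      (\prod_(t < s) (#|f t| == a t)) *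
      \prod_(t < s) (forest_size (f t) == b t).
  under eq_bigr do rewrite countE.
  by rewrite bigA_distr_bigA; apply: eq_bigr => f _; rewrite big_split.
under eq_bigr => a _ do under eq_bigr => b _ do rewrite prodE.
under eq_bigr => a _ do rewrite exchange_big /=.
rewrite exchange_big planted_gfX !coef_sum big_mkcond /=.
apply: eq_bigr => f _; under [RHS]eq_bigr do rewrite -big_distrr /=.
rewrite -[RHS]big_distrl /=.
rewrite (@sum_profile s i (fun t => #|f t|) _
  ((\sum_t #|f t| == i) && [forall t, f t != set0])); first last.
- by case/andP=> /eqP <- _ t; rewrite (bigD1 t) //= leq_addr.
- move=> a ha; rewrite inE; congr (_ && _).
    by congr (_ == _); apply: eq_bigr.
  by apply: eq_forallb => t; rewrite ha card_gt0.
rewrite (@sum_profile s j (fun t => forest_size (f t)) _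
  (\sum_t forest_size (f t) + s == j)); first last.
- by move=> /eqP <- t; rewrite (bigD1 t) //= -addnA leq_addr.
- by move=> b hb; rewrite inE; congr (_ + _ == _); apply: eq_bigr.
rewrite mulnb; case: ifP => _; last by rewrite andbF.
by rewrite coef_bimonomial andbT.
Qed.

(** Expand the k-th power in forest_gfS by the binomial theorem. The term s is
    the number of subtrees met by the set of leaves; the term 0 has no
    coefficient in positive degree i. *)
Lemma lcm_count_rec n i j : 0 < i -> count n.+1 i j =
  \sum_(1 <= s < k.+1) \sum_(a in indexA i s) \sum_(b in indexB j s)
    'C(k, s) * \prod_(t < s) count n (a t) (b t).
Proof.
move=> i0; rewrite -coef_forest_gf forest_gfS addrC exprDn !coef_sum.
rewrite big_ord_recl /= expr1n expr0 mulr1 bin0 mulr1n.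
rewrite coef1 eqn0Ngt i0 coef0 add0r.
rewrite big_add1 big_mkord; apply: eq_bigr => s _.
rewrite /= expr1n mul1r !coefMn coef_planted_gfX.
rewrite -[LHS]mulr_natl natn; under [RHS]eq_bigr do rewrite -big_distrr /=.
by rewrite -big_distrr.
Qed.

End Recursion.

(** * Betti numbers of path ideals *)

Section Main.
Variables (K : fieldType) (k : nat).
Local Notation count n := (lcm_count (@path_mnm k n)).

Lemma betti_quotE n i j : betti_quot K k n.+1 i j = count n.+1 i j.
Proof.
exact: (betti_quot_monomial (@path_monomialE K k n.+1) (@path_mlcm_strict k n)).
Qed.

Lemma betti_idealE n i j : betti_ideal K k n.+1 i j = count n.+1 i.+1 j.
Proof.
exact: (betti_ideal_monomial (@path_monomialE K k n.+1)
  (@path_mlcm_strict k n)).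
Qed.

(** Summing over j forgets the degree of the lcm, so that all i-subsets of the
    leaves are counted. The sum is over all of nat, with finite support. *)
Lemma total_betti_quotE n i : total_betti_quot K k n.+1 i = 'C(k ^ n.+1, i).
Proof.
(* A bound beyond which all Betti numbers in homological degree i vanish. *)
have [m le_m] : exists m, forall A : {set leaf k n.+1}, forest_size A <= m.
  exists (\max_(A : {set leaf k n.+1}) forest_size A) => A.
  exact: leq_bigmax.
rewrite /total_betti_quot /total_betti.
rewrite -(fsbig_widen [set` iota 0 m.+1]%classic) //; last first.
  move=> j [_ /= jN]; have {jN} : j \notin iota 0 m.+1 by apply/negP.
  rewrite mem_iota -leqNgt => m_lt_j.
  rewrite -[betti _ _ _]/(betti_quot K k n.+1 i j) betti_quotE.
  apply/eqP; rewrite cards_eq0; apply/eqP/setP => A; rewrite !inE.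
  apply/negP => /andP[_ /eqP A_j]; move: m_lt_j.
  by rewrite add0n -A_j ltnNge le_m.
rewrite -fsbig_seq ?iota_uniq // -[iota 0 m.+1]/(index_iota 0 m.+1) big_mkord.
under eq_bigr do rewrite -[betti _ _ _]/(betti_quot K k n.+1 i _) betti_quotE.
have -> : k ^ n.+1 = #|{: leaf k n.+1}| by rewrite card_tuple card_ord.
rewrite -card_draws -sum1_card.
rewrite (partition_big (fun A : {set leaf k n.+1} =>
  inord (forest_size A) : 'I_m.+1) xpredT) //.
apply: eq_bigr => j _.
rewrite /lcm_count -sum1_card; apply: eq_bigl => A; rewrite !inE.
by congr (_ && _); rewrite -[RHS]val_eqE /= inordK // ltnS le_m.
Qed.

End Main.

Theorem theorem3p3 (K : fieldType) (k : nat) (hk : 1 <= k) :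
  (forall n i : nat, 1 <= n -> total_betti_quot K k n i = 'C(k ^ n, i)) /\
  (forall n i j : nat, 2 <= n -> 1 <= i ->
     betti_ideal K k n (i - 1) j = betti_quot K k n i j /\
     betti_quot K k n i j =
       \sum_(1 <= s < k.+1) \sum_(a in indexA i s) \sum_(b in indexB j s)
         'C(k, s) * \prod_(t < s) betti_quot K k (n - 1) (a t) (b t)).
Proof.
split=> [[//|n] i _|[|[|n]] // [//|i] j _ _]; first exact: total_betti_quotE.
rewrite subn1 betti_idealE betti_quotE; split=> //.
rewrite subn1 lcm_count_rec //; apply: eq_bigr => s _.
apply: eq_bigr => a _; apply: eq_bigr => b _; congr (_ * _).
by apply: eq_bigr => t _; rewrite betti_quotE.
Qed.
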